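(* Suppose $F=\sum f_iX^{-i}$ is a formal Laurent series in $\mathbb{K}((X^{-1}))$, with continued fraction expansion $[a_0(X),a_1(X),\ldots]$ and thus with convergents given for $h=0,1,\ldots$ by the rational functions $$r_h(X)=x_h(X)/y_h(X)=[a_0(X),a_1(X),\ldots,a_h(X)].$$ Denote by $\overline F=\sum\overline f_iX^{-i}$ some specialisation of $F$ effected by specialising parameters of the field over which $F$ is defined, or a reduction of $F$; it is supposed that this specialisation or reduction $\overline F$ makes sense. Then the sequence of convergents to $\overline F$ is precisely the sequence $(\overline r_h(X))$ of the correspondingly specialised or reduced convergents of $F$, however listed without repetition.
   Context: Setting: $\mathbb{K}=K(t_1,t_2,\ldots)$ is an extension of a base field $K$ (taken to be $\mathbb{Q}$ or a finite field $\mathbb{F}_p$) by one or several algebraically independent parameters $t_1,t_2,\ldots$. A specialisation is a restriction on the generality of the parameters defining $\mathbb{K}$ over $K$, for example imposing a relation between the parameters, parametrising them, or giving them numerical values. A reduction of $F\in\mathbb{K}((X^{-1}))$ modulo $\mathfrak p$ is the replacement, if that makes sense, of $F$ by the corresponding series defined over $\mathbb{K}_{\mathfrak p}((X^{-1}))$, where $\mathfrak p$ is a maximal ideal of the ring of integers $\mathcal{O}_{\mathbb{K}}$ of $\mathbb{K}$ and $\mathbb{K}_{\mathfrak p}=\mathcal{O}_{\mathbb{K}}/\mathfrak p\mathcal{O}_{\mathbb{K}}$ (for example, replacing the base field $\mathbb{Q}$ by $\mathbb{F}_p$; this does not make sense if $p$ occurs in the denominator of some coefficient $f_i$). The bar denotes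 the result of the specialisation or reduction, applied to coefficients. Continued fractions: $[a_0,a_1,\ldots,a_h]=a_0+1/(a_1+1/(a_2+\cdots+1/a_h))$. The expansion of a Laurent series in $X^{-1}$ over a field is obtained by repeatedly taking the polynomial part as partial quotient $a_h(X)$ and inverting the remainder, stopping if the remainder is zero; so $\deg a_h\ge1$ for $h\ge1$. The continuants $x_h,y_h$ are the coprime polynomials given by $x_{-1}=1$, $y_{-1}=0$, $x_0=a_0$, $y_0=1$, $x_{h+1}=a_{h+1}x_h+x_{h-1}$, $y_{h+1}=a_{h+1}y_h+y_{h-1}$. Meaning of $\overline r_h$: it is the specialisation or reduction of the quotient $r_h=x_h/y_h$. If some partial quotient $a_h$ has no specialisation (its coefficients become infinite) then neither do the continuants $x_h$ and $y_h$; their quotient $r_h$ is nevertheless taken to have a defined specialisation, provided only that $\overline F$ makes sense: there is a constant $c_h\in\mathbb{K}$ such that $\overline{c_hx_h}$ and $\overline{c_hy_h}$ both exist and do not both vanish identically, and $\overline r_h=\overline{c_hx_h}/\overline{c_hy_h}$. Several distinct convergents $r_h,r_{h+1},\ldots$ of $F$ may collapse to the same convergent of $\overline F$.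
   Formalization: For specialisations of several parameters that are not places, a constant c_h need not exist (F = t1/X + t2/X², t1,t2 → 0, h = 1); the list runs over those h for which the specialised r_h is defined, and all h are shown to be defined when the specialisation is a place. *)

(* Defs.v *)
From HB Require Import structures.
From Stdlib Require Import ClassicalEpsilon.
From mathcomp Require Import all_boot all_order all_algebra.
From mathcomp Require Import fraction.
From mathcomp Require Import mpoly.

Set Implicit Arguments.
Unset Strict Implicit.
Unset Printing Implicit Defensive.

Import GRing.Theory.
Local Open Scope ring_scope.

Definition base_field (K : fieldType) : Prop :=
  (exists f : {rmorphism rat -> K}, bijective f) \/
  (exists2 p : nat, prime p & exists f : {rmorphism 'F_p -> K}, bijective f).

Definition algebraically_independent (K KK : fieldType)
    (iota : {rmorphism K -> KK}) (I : Type) (t : I -> KK) : Prop :=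
  forall (n : nat) (s : 'I_n -> I), injective s ->
  forall p : {mpoly K[n]}, mmap iota (t \o s) p = 0 -> p = 0.

Definition generated_by (K KK : fieldType)
    (iota : {rmorphism K -> KK}) (I : Type) (t : I -> KK) : Prop :=
  forall x : KK, exists (n : nat) (s : 'I_n -> I) (p q : {mpoly K[n]}),
    mmap iota (t \o s) q != 0 /\
    x = mmap iota (t \o s) p / mmap iota (t \o s) q.

(* KK = K(t_1, t_2, ...), with finitely or countably many parameters. *)
Definition rational_function_field (K KK : fieldType)
    (iota : {rmorphism K -> KK}) (I : countType) (t : I -> KK) : Prop :=
  [/\ inhabited I, algebraically_independent iota t & generated_by iota t].

(* Formal Laurent series sum_i f_i X^(-i) in the variable X^-1. The field lbnd
   is any bound on the degree in X, not necessarily the degree itself. *)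
Record laurent (K : fieldType) := Laurent {
  lcoef :> int -> K;
  lbnd : nat;
  lcoefP : forall n : nat, (lbnd < n)%N -> lcoef (- n%:Z) = 0
}.

Section ContinuedFraction.
Variable K : fieldType.
Implicit Types (F : laurent K) (r : nat -> K).

Definition poly_part F : {poly K} := \poly_(j < (lbnd F).+1) F (- j%:Z).

Definition frac_coef F (i : int) : K :=
  if i is Posz n.+1 then F n.+1%:Z else 0.

(* The list b_0, ..., b_n of the first coefficients of the inverse of
   the power series sum_j r_j T^j, r_0 != 0: they solve
   sum_(j <= n) r_(n - j) * b_j = (n == 0). *)
Fixpoint inv_seq r (n : nat) : seq K :=
  if n is n'.+1 then
    let s := inv_seq r n' in
    rcons s (- (r 0%N)^-1 * \sum_(j < n) r (n - j)%N * nth 0 s j)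
  else [:: (r 0%N)^-1].

Definition inv_coef r (n : nat) : K := nth 0 (inv_seq r n) n.

(* The inverse of sum_(j >= 0) r_j X^(-(m + j)). *)
Definition linv_coef (m : nat) r (i : int) : K :=
  if i + m%:Z is Posz n then inv_coef r n else 0.

Fact linv_coefP m r (n : nat) : (m < n)%N -> linv_coef m r (- n%:Z) = 0.
Proof.
move=> lt_mn; rewrite /linv_coef addrC.
have [k ->] : exists k, n = (m + k.+1)%N.
  by exists (n - m).-1; rewrite prednK ?subn_gt0 // subnKC // ltnW.
by rewrite PoszD opprD addrA subrr sub0r.
Qed.

Definition linv (m : nat) r : laurent K := Laurent (@linv_coefP m r).

(* The inverse of the remainder F - poly_part F, or None if it is zero. *)
Definition next_quotient F : option (laurent K) :=
  match excluded_middle_informative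
          (exists m : nat, frac_coef F m%:Z != 0) with
  | left e => let m := ex_minn e in
              Some (linv m (fun j => frac_coef F (m + j)%N%:Z))
  | right _ => None
  end.

(* None beyond the end of a terminating expansion. *)
Definition complete_quotient F (h : nat) : option (laurent K) :=
  iter h (obind next_quotient) (Some F).

Definition partial_quotient F (h : nat) : option {poly K} :=
  omap poly_part (complete_quotient F h).

(* a_h, with the junk value 0 beyond the end of a terminating expansion. *)
Definition pq F (h : nat) : {poly K} := odflt 0 (partial_quotient F h).

(* The pairs (x_h, x_(h-1)) and (y_h, y_(h-1)). *)
Fixpoint numer_pair F (h : nat) : {poly K} * {poly K} :=
  if h is h'.+1 then
    let u := numer_pair F h' in (pq F h * u.1 + u.2, u.1)
  else (pq F 0, 1).

Fixpoint denom_pair F (h : nat) : {poly K} * {poly K} :=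
  if h is h'.+1 then
    let u := denom_pair F h' in (pq F h * u.1 + u.2, u.1)
  else (1, 0).

Definition numer F (h : nat) : {poly K} := (numer_pair F h).1.
Definition denom F (h : nat) : {poly K} := (denom_pair F h).1.

Definition has_convergent F (h : nat) : bool := isSome (partial_quotient F h).

Definition convergent F (h : nat) : option {fraction {poly K}} :=
  if has_convergent F h then Some (tofrac (numer F h) / tofrac (denom F h))
  else None.

End ContinuedFraction.

(* A specialisation or reduction: a ring morphism to a field L, defined on the
   subring sp_dom of those elements of KK whose specialisation makes sense. By
   sp_local, f / g makes sense as soon as f and g do and g does not specialise
   to 0. The values of sp_map outside sp_dom are irrelevant. *)
Record specialisation (KK L : fieldType) := Specialisation {
  sp_dom : {pred KK};
  sp_map :> KK -> L;
  sp_domP : subring_closed sp_dom;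
  sp_map1 : sp_map 1 = 1;
  sp_mapB : {in sp_dom &, {morph sp_map : x y / x - y}};
  sp_mapM : {in sp_dom &, {morph sp_map : x y / x * y}};
  sp_local : forall x, x \in sp_dom -> sp_map x != 0 -> x^-1 \in sp_dom
}.

(* sp is a place: sp_dom is a valuation ring. By sp_local, elements outside
   sp_dom then have inverses specialising to 0. *)
Definition place (KK L : fieldType) (sp : specialisation KK L) : Prop :=
  forall x : KK, x \in sp_dom sp \/ x^-1 \in sp_dom sp.

Section Specialise.
Variables (KK L : fieldType) (sp : specialisation KK L).
Implicit Types (F : laurent KK) (c : nat -> KK).

Definition specialisable F : Prop := forall i : int, F i \in sp_dom sp.

Fact sp_map0 : sp 0 = 0.
Proof.
have [d1 _ _] := sp_domP sp.
by rewrite -[X in sp X](subrr 1) sp_mapB // subrr.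
Qed.

Fact sp_lcoefP F (n : nat) : (lbnd F < n)%N -> sp (F (- n%:Z)) = 0.
Proof. by move=> lt_n; rewrite lcoefP // sp_map0. Qed.

Definition sp_laurent F : laurent L :=
  @Laurent L (fun i => sp (F i)) (lbnd F) (@sp_lcoefP F).

Definition sp_poly (p : {poly KK}) : {poly L} := map_poly sp p.

(* a is a constant c_h by which r_h = x_h / y_h can be specialised. *)
Definition admissible F (h : nat) (a : KK) : Prop :=
  [/\ has_convergent F h,
      a *: numer F h \is a polyOver (sp_dom sp),
      a *: denom F h \is a polyOver (sp_dom sp)
    & ~ (sp_poly (a *: numer F h) = 0 /\ sp_poly (a *: denom F h) = 0)].

Definition sp_convergent F c (h : nat) : option {fraction {poly L}} :=
  match excluded_middle_informative (admissible F h (c h)) with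
  | left _ => Some (tofrac (sp_poly (c h *: numer F h)) /
                    tofrac (sp_poly (c h *: denom F h)))
  | right _ => None
  end.

End Specialise.

(* v is u listed without repetition (None marks an absent term): v_n is the
   value x whose first occurrence in u comes after exactly n distinct values. *)
Definition listed_without_repetition (T : eqType) (u v : nat -> option T) :
    Prop :=
  forall (n : nat) (x : T),
    v n = Some x <->
    exists h : nat,
      [/\ u h = Some x,
          forall j : nat, (j < h)%N -> u j <> Some x
        & size (undup (pmap u (iota 0 h))) = n].

(* Main.v *)
(* Let R = y_h F - x_h. It involves only powers of X below X^(-deg y_h), and two
   pairs (p, q), (p', q') with deg q, deg q' <= e for which q G - p and q' G - p'
   involve only powers below X^(-e) are proportional. Specialising the multiple
   c_h R by coefficients therefore shows that the specialised r_h is the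
   convergent X_k / Y_k of the specialised series, where k is the largest index
   with deg Y_k <= deg y_h; in particular k is nondecreasing in h.
   Conversely, for d = deg Y_k the Hankel determinant of order d of the
   specialised series does not vanish, hence neither does that of F, and Cramer's
   rule gives a denominator c_h y_h of degree exactly d, with coefficients in the
   domain of the specialisation and nonzero after specialisation. *)
From HB Require Import structures.
From Stdlib Require Import ClassicalEpsilon.
Require Import Defs.
From mathcomp Require Import all_boot all_order all_algebra.
From mathcomp Require Import fraction mpoly.
From mathcomp Require Import zify ring.

Set Implicit Arguments.
Unset Strict Implicit.
Unset Printing Implicit Defensive.

Import Order.TTheory GRing.Theory Num.Theory.
Local Open Scope ring_scope.

(** * Products of polynomials with coefficient sequences indexed by all integers *)

Section PolyAction.
Variable K : fieldType.
Implicit Types (p q w : {poly K}) (G : int -> K).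

(* [pact q G] is the product of q by the series whose coefficient of X^(-i) is
   G i; that series need not be bounded on either side. *)
Definition pact q G (i : int) : K := \sum_(j < size q) q`_j * G (i + j%:Z).

(** The series 1, so that [pact p ldelta] is the polynomial p viewed as a series. *)
Definition ldelta (i : int) : K := (i == 0)%:R.

Lemma pact_wide n q G i : (size q <= n)%N ->
  pact q G i = \sum_(j < n) q`_j * G (i + j%:Z).
Proof.
move=> le_qn; rewrite /pact (big_ord_widen n (fun j => q`_j * G (i + j%:Z))) //.
rewrite big_mkcond; apply: eq_bigr => j _; case: ltnP => // le_qj.
by rewrite nth_default // mul0r.
Qed.

Lemma eq_pact q G G' i : (forall j : nat, (j < size q)%N ->
  G (i + j%:Z) = G' (i + j%:Z)) -> pact q G i = pact q G' i.
Proof. by move=> eqG; apply: eq_bigr => j _; rewrite eqG. Qed.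

Lemma pactD p q G i : pact (p + q) G i = pact p G i + pact q G i.
Proof.
rewrite !(@pact_wide (maxn (size p) (size q))) ?leq_maxl ?leq_maxr ?size_polyD //.
by rewrite -big_split; apply: eq_bigr => j _; rewrite coefD mulrDl.
Qed.

Lemma pactZ a q G i : pact (a *: q) G i = a * pact q G i.
Proof.
rewrite (pact_wide _ _ (size_scale_leq a q)) mulr_sumr.
by apply: eq_bigr => j _; rewrite coefZ mulrA.
Qed.

Lemma pact0 G i : pact 0 G i = 0.
Proof. by rewrite /pact size_poly0 big_ord0. Qed.

Lemma pactB p q G i : pact (p - q) G i = pact p G i - pact q G i.
Proof. by rewrite pactD -scaleN1r pactZ mulN1r. Qed.

Lemma pactC c G i : pact c%:P G i = c * G i.
Proof.
by rewrite (@pact_wide 1) ?size_polyC ?leq_b1 // big_ord1 coefC eqxx addr0.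
Qed.

Lemma pact1 G i : pact 1 G i = G i.
Proof. by rewrite pactC mul1r. Qed.

Lemma pactMX q G i : pact (q * 'X) G i = pact q G (i + 1).
Proof.
rewrite (@pact_wide (size q).+1); last first.
  by have [->|nz_q] := eqVneq q 0; rewrite ?mul0r ?size_poly0 // size_mulX.
rewrite big_ord_recl coefMX mul0r add0r /pact; apply: eq_bigr => j _.
by rewrite coefMX -addrA /= /bump.
Qed.

Lemma pactM p q G i : pact (p * q) G i = pact p (pact q G) i.
Proof.
elim/poly_ind: p i => [|p c IHp] i; first by rewrite mul0r !pact0.
rewrite mulrDl mulrAC !pactD !pactMX IHp pactC mul_polyC pactZ //.
Qed.

Lemma pactXn n G i : pact 'X^n G i = G (i + n%:Z).
Proof.
elim: n i => [|n IHn] i; first by rewrite pact1 addr0.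
by rewrite exprSr pactMX IHn -addrA.
Qed.

Lemma pact_vanish q G i (m : int) : (forall j, j <= m -> G j = 0) ->
  i + (size q)%:Z <= m + 1 -> pact q G i = 0.
Proof.
move=> G0 le_m; apply: big1 => j _; rewrite G0 ?mulr0 //.
have := ltn_ord j; lia.
Qed.

Lemma pact_sub q G G' i :
  pact q (fun j => G j - G' j) i = pact q G i - pact q G' i.
Proof. by rewrite -sumrB; apply: eq_bigr => j _; rewrite mulrBr. Qed.

Lemma pact_ldelta p (n : nat) : pact p ldelta (- n%:Z) = p`_n.
Proof.
have [lt_np|le_pn] := ltnP n (size p).
  rewrite /pact (bigD1 (Ordinal lt_np)) //= /ldelta addNr eqxx mulr1 big1.
    by rewrite addr0.
  move=> j; rewrite -val_eqE /= => neq_jn.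
  by rewrite (_ : _ == _ = false) ?mulr0 //; lia.
rewrite nth_default //; apply: big1 => j _; have := ltn_ord j => lt_jp.
by rewrite /ldelta (_ : _ == _ = false) ?mulr0 //; lia.
Qed.

Lemma pact_ldelta_gt0 p i : 0 < i -> pact p ldelta i = 0.
Proof.
move=> i0; apply: big1 => j _.
by rewrite /ldelta (_ : _ == _ = false) ?mulr0 //; lia.
Qed.

Lemma pact_ldelta_inj p q :
  (forall i, i <= 0 -> pact p ldelta i = pact q ldelta i) -> p = q.
Proof. by move=> e; apply/polyP => n; rewrite -!pact_ldelta e //; lia. Qed.

(* The series q G - p. *)
Definition resid G q p i := pact q G i - pact p ldelta i.

Lemma pact_resid G w q p i :
  pact w (resid G q p) i = pact (w * q) G i - pact (w * p) ldelta i.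
Proof. by rewrite pact_sub !pactM. Qed.

(* q p' - p q' = q' (q G - p) - q (q' G - p') has no nonnegative powers of X. *)
Lemma resid_cross (e : nat) G q p q' p' :
    (size q <= e.+1)%N -> (size q' <= e.+1)%N ->
    (forall i, i <= e%:Z -> resid G q p i = 0) ->
    (forall i, i <= e%:Z -> resid G q' p' i = 0) ->
  q * p' = p * q'.
Proof.
move=> sq sq' r0 r0'; apply: pact_ldelta_inj => i i0.
(* For i <= 0 and size q <= e + 1, multiplying by q cannot bring a term of index above e down to
   index i. *)
have := pact_vanish (q := q) (i := i) r0'; rewrite pact_resid.
have := pact_vanish (q := q') (i := i) r0; rewrite pact_resid.
rewrite (mulrC q' q) (mulrC q' p) => e1 e2.
by rewrite -(subr0_eq (e2 _)) ?(subr0_eq (e1 _)) //; lia.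
Qed.

Lemma pact_lbnd (F : laurent K) q (n : nat) :
  (lbnd F + size q < n)%N -> pact q F (- n%:Z) = 0.
Proof.
move=> lt_n; apply: big1 => j _; have lt_j := ltn_ord j.
have -> : - n%:Z + j%:Z = - (n - j)%N%:Z by lia.
by rewrite lcoefP ?mulr0 //; lia.
Qed.

(** The polynomial part of q F: the numerator that goes with the denominator q. The range suffices
    by [pact_lbnd]. *)
Definition poly_part_mul (F : laurent K) q : {poly K} :=
  \poly_(j < (lbnd F + size q).+1) pact q F (- j%:Z).

Lemma resid_poly_part_mul (F : laurent K) q i :
  i <= 0 -> resid F q (poly_part_mul F q) i = 0.
Proof.
move=> i0; have -> : i = - `|i|%N%:Z by lia.
rewrite /resid pact_ldelta coef_poly ltnS; case: leqP => lt; first exact: subrr.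
by rewrite subr0 pact_lbnd.
Qed.

Lemma resid_gt0 G q p i : 0 < i -> resid G q p i = pact q G i.
Proof. by move=> i0; rewrite /resid pact_ldelta_gt0 // subr0. Qed.

End PolyAction.

(** * Inverses of series in X^-1 *)

Section Inverse.
Variables (K : fieldType) (r : nat -> K).
Hypothesis r0 : r 0%N != 0.

Lemma size_inv_seq n : size (inv_seq r n) = n.+1.
Proof. by elim: n => //= n IHn; rewrite size_rcons IHn. Qed.

Lemma nth_inv_seq n j : (j <= n)%N -> nth 0 (inv_seq r n) j = inv_coef r j.
Proof.
elim: n => [|n IHn] le_jn; first by case: j le_jn.
have [->//|neq] := eqVneq j n.+1.
by rewrite /= nth_rcons size_inv_seq ltn_neqAle neq le_jn IHn //; lia.
Qed.

Lemma inv_coefS n : inv_coef r n.+1 =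
  - (r 0%N)^-1 * \sum_(j < n.+1) r (n.+1 - j)%N * inv_coef r j.
Proof.
rewrite {1}/inv_coef /= nth_rcons size_inv_seq ltnn eqxx.
by congr (_ * _); apply: eq_bigr => j _; rewrite nth_inv_seq // -ltnS.
Qed.

Lemma inv_coefP n : \sum_(j < n.+1) r (n - j)%N * inv_coef r j = (n == 0%N)%:R.
Proof.
case: n => [|n]; first by rewrite big_ord1 /inv_coef /= mulfV.
by rewrite big_ord_recr /= subnn inv_coefS mulNr mulrN mulVKf // subrr.
Qed.

Lemma linvE m (n : nat) : linv m r (n%:Z - m%:Z) = inv_coef r n.
Proof. by rewrite /= /linv_coef subrK. Qed.

Lemma linv_lt0 m i : i + m%:Z < 0 -> linv m r i = 0.
Proof. by rewrite /= /linv_coef; case: (i + m%:Z). Qed.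

(** The inverse of r_0 X^(-m) + ... has leading term r_0^(-1) X^m. *)
Lemma size_poly_part_linv m : size (poly_part (linv m r)) = m.+1.
Proof.
apply/eqP; rewrite size_poly_eq //=.
rewrite (_ : - _ = 0%N%:Z - m%:Z); last by lia.
by rewrite -[linv_coef _ _ _]/(linv m r _) linvE /inv_coef /= invr_neq0.
Qed.

(* The truncation to its first N terms of the product of
   sum_j r_j X^(-(m + j)) by G. *)
Definition trunc_mul m N (G : int -> K) i :=
  \sum_(j < N) r j * G (i - m%:Z - j%:Z).

Lemma trunc_mul_pact m N q G i :
  trunc_mul m N (pact q G) i = pact q (trunc_mul m N G) i.
Proof.
rewrite /trunc_mul /pact; under eq_bigr do rewrite mulr_sumr.
rewrite exchange_big; apply: eq_bigr => l _; rewrite mulr_sumr.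
apply: eq_bigr => j _; rewrite mulrCA; congr (_ * (_ * G _)); lia.
Qed.

(** [linv m r] starts at X^m, so only the r_j with j <= i contribute at index i: for i < N the
    truncation loses nothing, and [inv_coefP] applies. *)
Lemma trunc_mul_linv m N i : i < N%:Z ->
  trunc_mul m N (linv m r) i = ldelta K i.
Proof.
move=> lt_iN; case: i lt_iN => n lt_nN; last first.
  rewrite /ldelta (_ : _ == _ = false) //; apply: big1 => j _.
  by rewrite linv_lt0 ?mulr0 //; lia.
rewrite /ldelta -[n%:Z == 0]/(n == 0)%N -inv_coefP (reindex_inj rev_ord_inj).
have leN : (n.+1 <= N)%N by lia.
rewrite /trunc_mul [RHS](big_ord_widen N
  (fun j => r (n - (n.+1 - j.+1))%N * inv_coef r (n.+1 - j.+1)%N)) //.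
rewrite [RHS]big_mkcond; apply: eq_bigr => j _; case: ltnP => le_nj.
  have -> : (n - (n.+1 - j.+1))%N = j by lia.
  by congr (_ * _); rewrite -(linvE m); congr (linv _ _ _); lia.
by rewrite linv_lt0 ?mulr0 //; lia.
Qed.

Lemma trunc_mul_ldelta m N i : i < N%:Z ->
  trunc_mul m N (@ldelta K) i = if i - m%:Z is Posz n then r n else 0.
Proof.
move=> lt_iN; rewrite /trunc_mul; case e: (i - m%:Z) => [n|n]; last first.
  by apply: big1 => j _; rewrite /ldelta (_ : _ == _ = false) ?mulr0 //; lia.
have lt_nN : (n < N)%N by lia.
rewrite (bigD1 (Ordinal lt_nN)) //= /ldelta subrr eqxx mulr1 big1 ?addr0 // => j.
rewrite -val_eqE /= => neq.
by rewrite (_ : _ == _ = false) ?mulr0 //; lia.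
Qed.

(* If phi = sum_j r_j X^(-(m + j)) and G = 1 / phi, then
   p phi - q = - phi (q G - p). *)
Lemma resid_linv (phi : int -> K) m q p i :
    (forall i, phi i = if i - m%:Z is Posz n then r n else 0) ->
    (forall j, j <= i - m%:Z -> resid (linv m r) q p j = 0) ->
  resid phi p q i = 0.
Proof.
(* N exceeds every index i + j with j below size p or size q, so all truncated products used below
   are exact. *)
move=> phiE r_eq0; pose N := (`|i| + size p + size q)%N.
have : trunc_mul m N (resid (linv m r) q p) i = 0.
  by apply: big1 => j _; rewrite r_eq0 ?mulr0 //; lia.
have -> : trunc_mul m N (resid (linv m r) q p) i =
  trunc_mul m N (pact q (linv m r)) i - trunc_mul m N (pact p (@ldelta K)) i.
  by rewrite -sumrB; apply: eq_bigr => j _; rewrite mulrBr.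
rewrite !trunc_mul_pact (@eq_pact _ q _ (@ldelta K)); last first.
  by move=> j lt_j; apply: trunc_mul_linv; lia.
rewrite (@eq_pact _ p _ phi); last first.
  by move=> j lt_j; rewrite phiE; apply: trunc_mul_ldelta; lia.
by move/eqP; rewrite /resid -opprB oppr_eq0 => /eqP.
Qed.

End Inverse.

(** * Continuants and best approximation *)

Section Convergents.
Variable K : fieldType.
Implicit Types (F G : laurent K).

(** In the second case m is the order of the fractional part of F and r lists its coefficients from
    there on; m is positive since [frac_coef] is 0 at index 0. *)
Variant next_quotient_spec F : option (laurent K) -> Prop :=
  | NextNone of (forall i, frac_coef F i = 0) : next_quotient_spec F None
  | NextSome m r of (0 < m)%N & r 0%N != 0
      & (forall i, frac_coef F i = if i - m%:Z is Posz n then r n else 0) :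
      next_quotient_spec F (Some (linv m r)).

Lemma next_quotientP F : next_quotient_spec F (next_quotient F).
Proof.
rewrite /next_quotient; case: excluded_middle_informative => [ex|nex]; last first.
  constructor=> -[n|//]; apply/eqP/negPn/negP => nz; apply: nex; by exists n.
case: ex_minnP => m nz_m min_m; constructor.
- by case: m nz_m {min_m} => //=; rewrite eqxx.
- by rewrite addn0.
move=> i; case e: (i - m%:Z) => [n|n]; first by congr frac_coef; lia.
case: i e => [i|//] e; apply/eqP/negPn/negP => /min_m; lia.
Qed.

Lemma resid0 F i : resid F 1 (pq F 0) i = frac_coef F i.
Proof.
rewrite /pq /= /resid pact1; case: i => [[|n]|n].
- by rewrite -[0%N%:Z]/(- 0%N%:Z) pact_ldelta coef_poly subrr.
- by rewrite pact_ldelta_gt0 // subr0.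
rewrite NegzE pact_ldelta coef_poly ltnS /=; case: ltnP => [_|lt]; first exact: subrr.
by rewrite subr0 lcoefP.
Qed.

Lemma has_convergent0 F : has_convergent F 0.
Proof. by []. Qed.

(** Peels off the first step instead of the last, so that inductions on h can pass from F to its
    next complete quotient G. *)
Lemma complete_quotientS F h : complete_quotient F h.+1 =
  obind (fun G => complete_quotient G h) (next_quotient F).
Proof.
rewrite /complete_quotient iterSr /=; case: next_quotient => //=.
by elim: h => //= h ->.
Qed.

Lemma has_convergentS F h : has_convergent F h.+1 =
  if next_quotient F is Some G then has_convergent G h else false.
Proof.
rewrite /has_convergent /partial_quotient complete_quotientS.
by case: next_quotient.
Qed.

Lemma has_convergent_le F h k : (k <= h)%N ->
  has_convergent F h -> has_convergent F k.
Proof.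
elim: h k F => [|h IHh] [|k] F //= le_kh; rewrite !has_convergentS.
by case: next_quotient => // G; apply: IHh.
Qed.

Lemma pqS F G h : next_quotient F = Some G -> pq F h.+1 = pq G h.
Proof. by rewrite /pq /partial_quotient complete_quotientS => ->. Qed.

(** From [a_0, ..., a_(h+1)] = a_0 + 1 / [a_1, ..., a_(h+1)]: both pairs obey the same recurrence
    and start from (a_1, 1). *)
Lemma denom_pairS F G h :
  next_quotient F = Some G -> denom_pair F h.+1 = numer_pair G h.
Proof.
move=> nF; elim: h => [|h IHh]; first by rewrite /= (pqS _ nF) mulr1 addr0.
rewrite -[LHS]/(let u := denom_pair F h.+1 in (pq F h.+2 * u.1 + u.2, u.1)).
by rewrite IHh (pqS _ nF).
Qed.

Lemma numer_pairS F G h : next_quotient F = Some G -> numer_pair F h.+1 =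
  (pq F 0 * (numer_pair G h).1 + (denom_pair G h).1,
   pq F 0 * (numer_pair G h).2 + (denom_pair G h).2).
Proof.
move=> nF; elim: h => [|h IHh].
  by rewrite /= (pqS _ nF) mulr1 addr0 mulrC.
rewrite -[LHS]/(let u := numer_pair F h.+1 in (pq F h.+2 * u.1 + u.2, u.1)).
rewrite IHh (pqS _ nF) /=; congr (_, _); ring.
Qed.

Lemma denomS F G h : next_quotient F = Some G -> denom F h.+1 = numer G h.
Proof. by rewrite /denom /numer => /denom_pairS->. Qed.

Lemma numerS F G h : next_quotient F = Some G ->
  numer F h.+1 = pq F 0 * numer G h + denom G h.
Proof. by rewrite /numer /denom => /numer_pairS->. Qed.

Lemma denom0 F : denom F 0 = 1.
Proof. by []. Qed.

Lemma numer0 F : numer F 0 = pq F 0.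
Proof. by []. Qed.

Lemma pq0_linv m (r : nat -> K) : r 0%N != 0 -> size (pq (linv m r) 0) = m.+1.
Proof. by move=> r0; apply: size_poly_part_linv. Qed.

(** Meant for complete quotients after the first, where deg a_0 >= 1: in x_(h+1) = a_0 x'_h + y'_h,
    with x', y' the continuants of G, the first term then dominates. *)
Lemma size_numer F h m : size (pq F 0) = m.+2 -> has_convergent F h ->
  (0 < size (denom F h))%N /\ size (numer F h) = (size (denom F h) + m.+1)%N.
Proof.
elim: h F m => [|h IHh] F m szF; first by rewrite numer0 denom0 size_poly1 szF.
rewrite has_convergentS; case e: next_quotient => [G|//] hG.
rewrite (numerS _ e) (denomS _ e); case: next_quotientP e => // m' r m0 r0 _ [eG].
have szG: size (pq G 0) = m'.-1.+2 by rewrite -eG pq0_linv // prednK.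
have [D0 szN] := IHh _ _ szG hG; split; first by rewrite szN; lia.
have nzN : numer G h != 0 by rewrite -size_poly_eq0 szN; lia.
have nzF : pq F 0 != 0 by rewrite -size_poly_eq0 szF.
rewrite size_polyDl size_mul // szF szN; lia.
Qed.

Lemma size_denomS F G h m r : next_quotient F = Some G -> G = linv m r ->
  (0 < m)%N -> r 0%N != 0 -> has_convergent G h ->
  (0 < size (denom G h))%N /\ size (denom F h.+1) = (size (denom G h) + m)%N.
Proof.
move=> e eG m0 r0; rewrite (denomS _ e) => /size_numer H.
have := H m.-1; rewrite prednK //; apply.
by rewrite eG pq0_linv.
Qed.

Lemma size_denom_gt0 F h : has_convergent F h -> (0 < size (denom F h))%N.
Proof.
case: h => [|h]; first by rewrite denom0 size_poly1.
rewrite has_convergentS; case e: next_quotient => [G|//] hG.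
case: next_quotientP (e) => // m r m0 r0 _ [eG].
have [] := size_denomS e (esym eG) m0 r0 hG; lia.
Qed.

(** Passing from F to G lowers both sizes by the same m, which reduces the claim to h = 0. *)
Lemma size_denom_ltS F h : has_convergent F h.+1 ->
  (size (denom F h) < size (denom F h.+1))%N.
Proof.
elim: h F => [|h IHh] F; rewrite has_convergentS;
  case e: next_quotient => [G|//] hG; case: next_quotientP (e) => // m r m0 r0 _ [eG].
  have [] := size_denomS e (esym eG) m0 r0 hG; rewrite denom0 size_poly1; lia.
have [_ ->] := size_denomS e (esym eG) m0 r0 hG.
have hG' : has_convergent G h by apply: has_convergent_le hG.
have [_ ->] := size_denomS e (esym eG) m0 r0 hG'.
by rewrite ltn_add2r IHh.
Qed.

Lemma size_denom_lt F h k : (h < k)%N -> has_convergent F k ->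
  (size (denom F h) < size (denom F k))%N.
Proof.
elim: k => // k IHk; rewrite ltnS leq_eqVlt => /orP[/eqP->|lt_hk] hFk.
  exact: size_denom_ltS.
apply: leq_trans (size_denom_ltS hFk); apply/ltnW/(IHk lt_hk).
exact: has_convergent_le hFk.
Qed.

Lemma size_denom_inj F h k : has_convergent F h -> has_convergent F k ->
  size (denom F h) = size (denom F k) -> h = k.
Proof.
move=> hh hk e; case: (ltngtP h k) => // lt.
  by have := size_denom_lt lt hk; rewrite e ltnn.
by have := size_denom_lt lt hh; rewrite e ltnn.
Qed.

Lemma size_denom_ltE F h k : has_convergent F h -> has_convergent F k ->
  (size (denom F h) < size (denom F k))%N = (h < k)%N.
Proof.
move=> hh hk; case: (ltngtP h k) => [lt|lt|->]; last by rewrite ltnn.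
  by rewrite size_denom_lt.
by apply/negbTE; rewrite -leqNgt ltnW // size_denom_lt.
Qed.

Lemma denom_neq0 F h : has_convergent F h -> denom F h != 0.
Proof. by move/size_denom_gt0; rewrite size_poly_gt0. Qed.

Lemma coprime_numer_denom F h :
  has_convergent F h -> coprimep (numer F h) (denom F h).
Proof.
elim: h F => [|h IHh] F; first by rewrite denom0 coprimep1.
rewrite has_convergentS; case e: next_quotient => [G|//] /IHh.
rewrite (numerS _ e) (denomS _ e) coprimep_sym => cop.
by rewrite coprimep_sym coprimep_addl_mul coprimep_sym.
Qed.

(** By Gauss's lemma: y_h is coprime to x_h and divides q x_h, hence divides q. *)
Lemma convergent_proportional F h (p q : {poly K}) : has_convergent F h ->
  q * numer F h = p * denom F h ->
  exists g : {poly K}, p = g * numer F h /\ q = g * denom F h.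
Proof.
move=> hF e; have cop := coprime_numer_denom hF; have nz := denom_neq0 hF.
have : denom F h %| q * numer F h by rewrite e dvdp_mulIr.
rewrite Gauss_dvdpl; last by rewrite coprimep_sym.
move=> /dvdpP[g eq]; exists g; split=> //; apply: (mulIf nz).
by rewrite -e eq mulrAC.
Qed.

(* Writing F = a_0 + 1/G, one has
   y_(h+1) F - x_(h+1) = - (y'_h G - x'_h) / G with x', y' the continuants of G. *)
Lemma resid_convergent F h i : has_convergent F h ->
    (has_convergent F h.+1 -> i + 1 < (size (denom F h.+1))%:Z) ->
  resid F (denom F h) (numer F h) i = 0.
Proof.
elim: h F i => [|h IHh] F i; rewrite ![has_convergent F _.+1]has_convergentS.
  rewrite resid0 => _; case e: next_quotient => [G|] lt_i; last first.
    by case: next_quotientP e => // ->.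
  case: next_quotientP (e) => // m r m0 r0 fE [eG].
  have [_ szD] := size_denomS e (esym eG) m0 r0 (has_convergent0 G).
  move: lt_i; rewrite szD denom0 size_poly1 fE => /(_ isT) lt_i.
  by case e': (i - m%:Z) => [n|//]; lia.
case e: next_quotient => [G|//] hG lt_i.
case: next_quotientP (e) => // m r m0 r0 fE [eG].
have rG j : j <= i - m%:Z -> resid (linv m r) (denom G h) (numer G h) j = 0.
  rewrite eG => le_j; apply: IHh => // hG'.
  have [_ szD] := size_denomS e (esym eG) m0 r0 hG'.
  by have := lt_i hG'; rewrite szD; lia.
rewrite (denomS _ e) (numerS _ e) -(resid_linv r0 (phi := frac_coef F) fE rG).
have -> : resid (frac_coef F) (numer G h) (denom G h) i =
  resid (resid F 1 (pq F 0)) (numer G h) (denom G h) i.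
  by congr (_ - _); apply: eq_pact => j _; rewrite resid0.
rewrite [RHS]/resid pact_resid mulr1 /resid pactD (mulrC (numer G h)); ring.
Qed.

Lemma exists_convergent_le F e : exists k,
  [/\ has_convergent F k, (size (denom F k) <= e.+1)%N
    & has_convergent F k.+1 -> (e.+1 < size (denom F k.+1))%N].
Proof.
(* Sizes of denominators grow by at least 1 at each step, so a search among the indices n <= e + 1
   must stop. *)
suff H n : (exists k, [/\ has_convergent F k, (size (denom F k) <= e.+1)%N
    & has_convergent F k.+1 -> (e.+1 < size (denom F k.+1))%N]) \/
    (has_convergent F n /\ (n < size (denom F n) <= e.+1)%N).
  by case: (H e.+1) => // -[_]; lia.
elim: n => [|n [?|[hn le_n]]]; [|by left|].
  by right; rewrite denom0 size_poly1.
case hS: (has_convergent F n.+1); last first.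
  by left; exists n; rewrite hS; split=> //; lia.
have [le_S|lt_S] := leqP (size (denom F n.+1)) e.+1.
  by right; split=> //; have := size_denom_ltS hS; lia.
by left; exists n; split=> //; lia.
Qed.

(** The next denominator, if any, has degree above e, so y_k F - x_k also involves only powers below
    X^(-e) and [resid_cross] applies. *)
Lemma best_approximation F k (e : nat) (p q : {poly K}) : has_convergent F k ->
    (size (denom F k) <= e.+1)%N ->
    (has_convergent F k.+1 -> (e.+1 < size (denom F k.+1))%N) ->
    (size q <= e.+1)%N -> (forall i, i <= e%:Z -> resid F q p i = 0) ->
  exists g : {poly K}, p = g * numer F k /\ q = g * denom F k.
Proof.
move=> hk le_k lt_k le_q r0; apply: convergent_proportional => //.
apply: (resid_cross (e := e) (G := F)) => // i le_i.
by apply: resid_convergent => // /lt_k; lia.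
Qed.

Lemma convergent_eq F k (p q : {poly K}) x : convergent F k = Some x -> q != 0 ->
  q * numer F k = p * denom F k -> x = tofrac p / tofrac q.
Proof.
rewrite /convergent; case: ifP => // hk [<-] nz_q e.
apply/eqP; rewrite eqr_div ?tofrac_eq0 ?denom_neq0 // -!tofracM tofrac_eq.
by rewrite mulrC e.
Qed.

(** Equal convergents have denominators dividing each other, hence of equal size, and the size
    determines the index. *)
Lemma convergent_inj F k k' x :
  convergent F k = Some x -> convergent F k' = Some x -> k = k'.
Proof.
move=> ck ck'; have hk : has_convergent F k.
  by move: ck; rewrite /convergent; case: ifP.
have hk' : has_convergent F k' by move: ck'; rewrite /convergent; case: ifP.
have cross : denom F k' * numer F k = numer F k' * denom F k.
  move: ck ck'; rewrite /convergent hk hk' => -[<-] [] /esym/eqP.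
  rewrite eqr_div ?tofrac_eq0 ?denom_neq0 // -!tofracM tofrac_eq => /eqP <-.
  exact: mulrC.
have [g [_ eg]] := convergent_proportional hk cross.
have [g' [_ eg']] : exists g,
    numer F k = g * numer F k' /\ denom F k = g * denom F k'.
  by apply: convergent_proportional => //; rewrite mulrC -cross mulrC.
have le : forall a b c : {poly K}, a != 0 -> a = b * c -> (size c <= size a)%N.
  by move=> a b c nz ea; apply: dvdp_leq; rewrite // ea dvdp_mulIr.
apply: (size_denom_inj hk hk'); apply/eqP; rewrite eqn_leq.
by rewrite (le _ _ _ (denom_neq0 hk') eg) (le _ _ _ (denom_neq0 hk) eg').
Qed.

End Convergents.

(** * Hankel determinants and Cramer's rule *)

Section Hankel.
Variable K : fieldType.
Implicit Types (q : {poly K}) (G : int -> K) (F : laurent K).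

(** Its left kernel consists of the q of size at most d for which q G has no term in X^-1, ...,
    X^-d. The entry type is left free so that the matrix can also be formed over the domain of a
    specialisation. *)
Definition hankel (T : Type) (d : nat) (G : int -> T) : 'M[T]_d :=
  \matrix_(i, j) G (i%:Z + 1 + j%:Z).

Lemma mul_hankel d q G (i : 'I_d) : (size q <= d)%N ->
  (poly_rV q *m hankel d G) 0 i = pact q G (i%:Z + 1).
Proof.
move=> le_qd; rewrite mxE (pact_wide _ _ le_qd); apply: eq_bigr => j _.
by rewrite !mxE; congr (_ * G _); lia.
Qed.

Lemma hankel_ker d q G : \det (hankel d G) != 0 -> (size q <= d)%N ->
  (forall i, 0 < i -> i <= d%:Z -> pact q G i = 0) -> q = 0.
Proof.
move=> nz_det le_qd q0; apply: contraNeq nz_det => nz_q; apply/det0P.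
exists (poly_rV q).
  by apply: contraNneq nz_q => e; rewrite -(poly_rV_K le_qd) e linear0.
apply/rowP => i; rewrite mul_hankel // q0 ?mxE //; have := ltn_ord i; lia.
Qed.

(** A kernel vector gives a nonzero q of degree below d which, by best approximation, is a multiple
    of the denominator of degree d. *)
Lemma det_hankel_convergent F k d : has_convergent F k ->
  size (denom F k) = d.+1 -> \det (hankel d F) != 0.
Proof.
move=> hk szk; apply/negP => /det0P[v nz_v v0].
have le_d : (size (rVpoly v) <= d)%N by exact: size_poly.
have [||||g [_ eg]] := @best_approximation _ F k d
  (poly_part_mul F (rVpoly v)) (rVpoly v) hk.
- by rewrite szk.
- by move/size_denom_ltS; rewrite szk.
- exact: leqW.
- move=> i le_i; have [i0|i0] := lerP i 0; first exact: resid_poly_part_mul.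
  rewrite resid_gt0 //; case: i i0 le_i => [[|i]|] // _ le_id.
  have lt_id : (i < d)%N by lia.
  have := mul_hankel F (Ordinal lt_id) le_d; rewrite rVpolyK v0 mxE /=.
  by rewrite -PoszD addn1 => <-.
have : denom F k %| rVpoly v by rewrite eg dvdp_mulIr.
move/dvdp_leq; rewrite szk => H; have : (d < d)%N; last by rewrite ltnn.
apply: leq_trans le_d; apply: H; apply: contraNneq nz_v => e.
by rewrite -(rVpolyK v) e linear0.
Qed.

(* Cramer's rule for the polynomial c X^d + ... whose product with G has no term
   in X^-1, ..., X^-d; c = \det (hankel d G) clears the denominators. *)
Definition cramer_row (R : comNzRingType) d (G : int -> R) : 'rV[R]_d :=
  (\row_j G (j%:Z + 1 + d%:Z)) *m \adj (hankel d G).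

Definition cramer_poly d G : {poly K} :=
  \det (hankel d G) *: 'X^d - rVpoly (cramer_row d G).

Lemma size_cramer_poly d G : (size (cramer_poly d G) <= d.+1)%N.
Proof.
rewrite (leq_trans (size_polyD _ _)) // geq_max size_polyN.
by rewrite (leq_trans (size_scale_leq _ _)) ?size_polyXn // leqW // size_poly.
Qed.

Lemma coef_cramer_poly d G : (cramer_poly d G)`_d = \det (hankel d G).
Proof.
by rewrite coefB coefZ coefXn eqxx mulr1 [X in _ - X]nth_default ?subr0 // size_poly.
Qed.

(** As \adj H *m H is the scalar matrix \det H, the row part contributes \det H * G (i + d) at index
    i, which cancels the term of X^d. *)
Lemma pact_cramer_poly d G i : 0 < i -> i <= d%:Z ->
  pact (cramer_poly d G) G i = 0.
Proof.
case: i => [[|i]|] // _ le_id; rewrite pactB pactZ pactXn.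
have lt_id : (i < d)%N by lia.
have -> : i.+1%:Z = i%:Z + 1 by lia.
have := mul_hankel G (Ordinal lt_id)
  (size_poly _ _ : size (rVpoly (cramer_row d G)) <= d)%N.
rewrite rVpolyK -mulmxA mul_adj_mx => <-.
by rewrite mul_mx_scalar !mxE subrr.
Qed.

End Hankel.

(** * Specialising convergents *)

Section Specialisation.
Variables (KK L : fieldType) (sp : specialisation KK L).

HB.instance Definition _ :=
  GRing.isSubringClosed.Build KK (sp_dom sp) (sp_domP sp).

(** The domain as a ring of its own: determinants and adjugates formed over it are carried to KK by
    [val] and to L by [sp_residue], both ring morphisms. *)
Record sp_ring := SpRing { sp_val :> KK; sp_valP : sp_val \in sp_dom sp }.
HB.instance Definition _ := [isSub for sp_val].
HB.instance Definition _ := [Choice of sp_ring by <:].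
HB.instance Definition _ := [SubChoice_isSubComNzRing of sp_ring by <:].

Definition sp_residue (x : sp_ring) : L := sp (val x).

Fact sp_residue_zmod_morphism : zmod_morphism sp_residue.
Proof.
by move=> x y; rewrite /sp_residue rmorphB /= sp_mapB ?sp_valP.
Qed.
HB.instance Definition _ :=
  GRing.isZmodMorphism.Build sp_ring L sp_residue sp_residue_zmod_morphism.

Fact sp_residue_monoid_morphism : monoid_morphism sp_residue.
Proof.
split=> [|x y]; rewrite /sp_residue ?rmorph1 ?sp_map1 //.
by rewrite rmorphM /= sp_mapM ?sp_valP.
Qed.
HB.instance Definition _ :=
  GRing.isMonoidMorphism.Build sp_ring L sp_residue sp_residue_monoid_morphism.

Lemma sp_sum (I : Type) (s : seq I) (f : I -> KK) :
    (forall i, f i \in sp_dom sp) ->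
  sp (\sum_(i <- s) f i) = \sum_(i <- s) sp (f i).
Proof.
move=> df; pose g i := SpRing (df i).
have -> : \sum_(i <- s) f i = val (\sum_(i <- s) g i) by rewrite rmorph_sum.
exact: (rmorph_sum sp_residue s predT g).
Qed.

Lemma coef_sp_poly p i : (sp_poly sp p)`_i = sp p`_i.
Proof. by rewrite coef_map_id0 // sp_map0. Qed.

Lemma size_sp_poly p : (size (sp_poly sp p) <= size p)%N.
Proof. exact: size_poly. Qed.

Lemma pact_sp_dom q (G : int -> KK) i : q \is a polyOver (sp_dom sp) ->
  (forall i, G i \in sp_dom sp) -> pact q G i \in sp_dom sp.
Proof.
move=> /polyOverP dq dG; apply: rpred_sum => j _; exact: rpredM.
Qed.

Lemma pact_sp_poly q (G : int -> KK) i : q \is a polyOver (sp_dom sp) ->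
    (forall i, G i \in sp_dom sp) ->
  pact (sp_poly sp q) (sp \o G) i = sp (pact q G i).
Proof.
move=> /polyOverP dq dG; rewrite (pact_wide _ _ (size_sp_poly q)) sp_sum.
  by apply: eq_bigr => j _; rewrite coef_sp_poly sp_mapM.
by move=> j; apply: rpredM.
Qed.

Lemma ldelta_sp_dom i : ldelta KK i \in sp_dom sp.
Proof. exact: rpred_nat. Qed.

Lemma sp_ldelta i : sp (ldelta KK i) = ldelta L i.
Proof. by rewrite /ldelta; case: eqP; rewrite ?sp_map1 ?sp_map0. Qed.

Lemma resid_sp_poly (G : int -> KK) q p i :
    q \is a polyOver (sp_dom sp) -> p \is a polyOver (sp_dom sp) ->
    (forall i, G i \in sp_dom sp) -> resid G q p i = 0 ->
  resid (sp \o G) (sp_poly sp q) (sp_poly sp p) i = 0.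
Proof.
move=> dq dp dG r0.
rewrite /resid pact_sp_poly // (@eq_pact _ _ (@ldelta L) (sp \o @ldelta KK)).
  rewrite pact_sp_poly //; last exact: ldelta_sp_dom.
  rewrite -sp_mapB ?pact_sp_dom //; last exact: ldelta_sp_dom.
  by rewrite -/(resid G q p i) r0 sp_map0.
by move=> j _ /=; rewrite sp_ldelta.
Qed.

Section CramerSpecialise.
Variables (G : int -> KK) (d : nat).
Hypothesis dG : forall i, G i \in sp_dom sp.
Let GO i := SpRing (dG i).

Let hankel_val : hankel d G = map_mx val (hankel d GO).
Proof. by apply/matrixP => i j; rewrite !mxE. Qed.

Lemma det_hankel_sp_dom : \det (hankel d G) \in sp_dom sp.
Proof. by rewrite hankel_val det_map_mx sp_valP. Qed.

Lemma sp_det_hankel : sp (\det (hankel d G)) = \det (hankel d (sp \o G)).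
Proof.
have -> : hankel d (sp \o G) = map_mx sp_residue (hankel d GO).
  by apply/matrixP => i j; rewrite !mxE.
by rewrite hankel_val !det_map_mx.
Qed.

Lemma cramer_poly_sp_dom : cramer_poly d G \is a polyOver (sp_dom sp).
Proof.
rewrite rpredB ?polyOverZ ?det_hankel_sp_dom ?polyOverXn //.
have -> : cramer_row d G = map_mx val (cramer_row d GO).
  rewrite /cramer_row hankel_val -map_mx_adj map_mxM; congr (_ *m _).
  by apply/rowP => j; rewrite !mxE.
apply/polyOverP => j; rewrite coef_rVpoly; case: insub => [k|]; last exact: rpred0.
by rewrite mxE sp_valP.
Qed.

End CramerSpecialise.

Lemma sp_residP (F : laurent KK) h a : specialisable sp F ->
  admissible sp F h a -> forall i, i < (size (denom F h))%:Z ->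
  resid (sp_laurent sp F) (sp_poly sp (a *: denom F h))
    (sp_poly sp (a *: numer F h)) i = 0.
Proof.
move=> dF [hF dn dd _] i lt_i; apply: resid_sp_poly => //.
rewrite /resid !pactZ -mulrBr -/(resid F _ _ i) resid_convergent ?mulr0 //.
by move/size_denom_ltS; lia.
Qed.

(** If the denominator specialised to 0, the remainder would be minus the specialised numerator; it
    has no nonnegative powers of X, so the numerator would vanish too, against admissibility. *)
Lemma sp_denom_neq0 (F : laurent KK) h a : specialisable sp F ->
  admissible sp F h a -> sp_poly sp (a *: denom F h) != 0.
Proof.
move=> dF adm; have [hF _ _ nz] := adm; apply/negP => /eqP q0; apply: nz; split=> //.
apply: pact_ldelta_inj => i i0.
have := sp_residP dF adm (i := i); rewrite q0 /resid !pact0 sub0r => r0.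
apply/eqP; rewrite -oppr_eq0 r0 //; have := size_denom_gt0 hF; lia.
Qed.

Lemma sp_convergent_bar (F : laurent KK) c h x : specialisable sp F ->
  sp_convergent sp F c h = Some x -> has_convergent F h /\ exists k,
    [/\ convergent (sp_laurent sp F) k = Some x,
        (size (denom (sp_laurent sp F) k) <= size (denom F h))%N
      & has_convergent (sp_laurent sp F) k.+1 ->
        (size (denom F h) < size (denom (sp_laurent sp F) k.+1))%N].
Proof.
move=> dF; rewrite /sp_convergent; case: excluded_middle_informative => // adm [<-].
have hF : has_convergent F h by case: adm.
split=> //; have Dgt0 := size_denom_gt0 hF.
have [k] := exists_convergent_le (sp_laurent sp F) (size (denom F h)).-1.
rewrite prednK // => -[hk le_k lt_k]; exists k; split=> //.
rewrite /convergent hk; congr Some.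
apply: (@convergent_eq _ (sp_laurent sp F) k); rewrite /convergent ?hk //.
  exact: sp_denom_neq0.
(* Here e is the degree of y_h: it bounds both denominators, and both remainders involve only powers
   below X^(-e). *)
apply: (@resid_cross _ (size (denom F h)).-1 (sp_laurent sp F)); rewrite ?prednK //.
- by rewrite (leq_trans (size_sp_poly _)) // size_scale_leq.
- by move=> i le_i; apply: sp_residP => //; lia.
by move=> i le_i; apply: resid_convergent => // /lt_k; lia.
Qed.

Lemma exists_admissible (F : laurent KK) k : specialisable sp F ->
  has_convergent (sp_laurent sp F) k -> exists h,
    size (denom F h) = size (denom (sp_laurent sp F) k) /\
    exists a, admissible sp F h a.
Proof.
move=> dF hk; case szk: (size _) => [|d]; first
  by have := size_denom_gt0 hk; rewrite szk.
have nz_bar := det_hankel_convergent hk szk.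
have nz_det : \det (hankel d F) != 0.
  apply: contraNneq nz_bar => e; rewrite -[hankel d _]/(hankel d (sp \o F)).
  by rewrite -sp_det_hankel // e sp_map0.
have [h [hF le_h lt_h]] := exists_convergent_le F d.
(* A smaller y_h would lie in the kernel of the Hankel matrix, since y_h F has no term in X^-1, ...,
   X^-d. *)
have szh : size (denom F h) = d.+1.
  apply/eqP; rewrite eqn_leq le_h /= ltnNge; apply: contraT => /negPn le_d.
  have := denom_neq0 hF; rewrite (hankel_ker nz_det le_d) ?eqxx // => i i0 le_i.
  rewrite -(resid_gt0 F _ (numer F h)) // resid_convergent // => /lt_h; lia.
exists h; split=> //.
pose q := cramer_poly d F; pose p := poly_part_mul F q.
have [||g [ep eq]] := best_approximation (p := p) (q := q) hF le_h lt_h.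
- exact: size_cramer_poly.
- move=> i le_i; have [i0|i0] := lerP i 0; first exact: resid_poly_part_mul.
  by rewrite resid_gt0 // pact_cramer_poly.
have nz_q : q != 0.
  by apply: contraNneq nz_det => e; rewrite -coef_cramer_poly -/q e coef0.
have nz_g : g != 0 by apply: contraNneq nz_q => e; rewrite eq e mul0r.
(* The Cramer denominator q = g y_h has degree at most d = deg y_h, so g is constant; it serves as
   the multiplier. *)
have [a eg] : exists a, g = a%:P.
  exists g`_0; apply: size1_polyC; have := size_cramer_poly d F; rewrite -/q eq.
  by rewrite size_mul ?denom_neq0 // szh addnS -[d.+1]add1n leq_add2r.
have dq : q \is a polyOver (sp_dom sp) by apply: cramer_poly_sp_dom.
exists a; split=> //; rewrite -!mul_polyC -eg -?ep -?eq //.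
  apply/polyOverP => j; rewrite coef_poly; case: ltnP => _; last exact: rpred0.
  exact: pact_sp_dom.
(* The coefficient of X^d in the specialised denominator is the Hankel determinant of the
   specialised series, which is nonzero. *)
case=> _ /(congr1 (fun s : {poly L} => s`_d)).
rewrite coef_sp_poly coef_cramer_poly coef0 sp_det_hankel // => /eqP.
exact/negP.
Qed.

(** Divisibility is total in a valuation ring, so among finitely many elements, not all 0, some
    nonzero one divides the others. *)
Lemma place_common_denominator (s : seq KK) : place sp -> has (predC1 0) s ->
  exists2 x, x \in s & x != 0 /\ forall y, y \in s -> y / x \in sp_dom sp.
Proof.
move=> plc; elim: s => //= y s IHs; have [s0|s0] := boolP (has (predC1 0) s).
  have [x xs [nz_x dx]] := IHs s0; have [dyx|dyx] := plc (y / x).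
    move=> _; exists x; first by rewrite inE xs orbT.
    by split=> // z; rewrite inE => /predU1P[->//|]; apply: dx.
  (* As 0^-1 = 0, this case of the disjunction may also occur with y = 0; then x is kept. Otherwise
     x / y is in the domain and y replaces x. *)
  have [y0 _|nz_y _] := eqVneq y 0.
    exists x; first by rewrite inE xs orbT.
    split=> // z; rewrite inE => /predU1P[->|]; last exact: dx.
    by rewrite y0 mul0r rpred0.
  exists y; first exact: mem_head.
  split=> // z; rewrite inE => /predU1P[->|/dx dz]; first by rewrite divff ?rpred1.
  have -> : z / y = z / x * (y / x)^-1 by rewrite invf_div mulrA divfK.
  exact: rpredM.
rewrite orbF => nz_y; exists y; first exact: mem_head.
split=> // z; rewrite inE => /predU1P[->|zs]; first by rewrite divff ?rpred1.
move/hasPn/(_ _ zs): s0 => /negPn/eqP->; by rewrite mul0r rpred0.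
Qed.

(** Dividing by a coefficient that divides all the others turns it into 1, which survives
    specialisation. *)
Lemma place_admissible (F : laurent KK) h : place sp -> has_convergent F h ->
  exists a, admissible sp F h a.
Proof.
move=> plc hF; pose s := (numer F h : seq KK) ++ (denom F h : seq KK).
have [|x xs [nz_x dx]] := @place_common_denominator s plc.
  apply/hasP; exists (lead_coef (denom F h)); last
    by rewrite /= lead_coef_eq0 denom_neq0.
  rewrite mem_cat lead_coefE mem_nth ?orbT //.
  by rewrite ltn_predL size_denom_gt0.
have dom (p : {poly KK}) : {subset (p : seq KK) <= s} ->
    x^-1 *: p \is a polyOver (sp_dom sp).
  move=> ps; apply/polyOverP => i; rewrite coefZ mulrC.
  have [lt_i|le_i] := ltnP i (size p); first by rewrite dx // ps // mem_nth.
  by rewrite nth_default // mul0r rpred0.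
exists x^-1; split=> //.
- by apply: dom => y ys; rewrite mem_cat ys.
- by apply: dom => y ys; rewrite mem_cat ys orbT.
have nz (p : {poly KK}) : x \in (p : seq KK) -> sp_poly sp (x^-1 *: p) <> 0.
  case/(nthP 0) => i _ ex /(congr1 (fun r : {poly L} => r`_i)).
  rewrite coef_sp_poly coefZ ex mulVf // sp_map1 coef0 => /eqP.
  by rewrite oner_eq0.
by case=> n0 d0; move: xs; rewrite mem_cat => /orP[/nz|/nz].
Qed.

End Specialisation.

(** * Listing without repetition, and the theorem *)

Lemma listed_without_repetition_by_degree (T : eqType)
    (u v : nat -> option T) (du dv : nat -> nat) :
    (forall j h, u j -> u h -> (du j < du h)%N = (j < h)%N) ->
    (forall k l, v k -> v l -> (dv k < dv l)%N = (k < l)%N) ->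
    (forall k l, (k <= l)%N -> v l -> v k) ->
    (forall k l x, v k = Some x -> v l = Some x -> k = l) ->
    (forall h x, u h = Some x -> exists2 k, v k = Some x & (dv k <= du h)%N) ->
    (forall k x, v k = Some x -> exists2 h, u h = Some x & du h = dv k) ->
  listed_without_repetition u v.
Proof.
move=> duE dvE v_le v_inj uv vu.
(* The first occurrence of v_k is the index h with du h = dv k: a term u_j with j < h equals some
   v_l with dv l <= du j < dv k, so l < k. *)
have first k x : v k = Some x -> exists h, [/\ u h = Some x,
    forall j, (j < h)%N -> u j <> Some x & size (undup (pmap u (iota 0 h))) = k].
  move=> vk; have [h uh dh] := vu _ _ vk; exists h; split=> // [j lt_jh uj|].
    have [k' /v_inj/(_ vk) -> ] := uv _ _ uj; rewrite -dh leqNgt duE ?uj ?uh //.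
    by rewrite lt_jh.
  have uniq_v : uniq (pmap v (iota 0 k)).
    elim: k {vk dh} => // k IHk; rewrite -addn1 iotaD pmap_cat cat_uniq IHk /=.
    case vk: (v k) => [y|] //=; rewrite orbF andbT mem_pmap.
    apply/mapP => -[l]; rewrite mem_iota add0n => lt_lk /esym vl.
    by rewrite (v_inj _ _ _ vl vk) ltnn in lt_lk.
  (* The values of u before h are exactly those of v before k: each v_l with l < k occurs in u at an
     index i with du i = dv l < du h, so i < h. *)
  have -> : size (undup (pmap u (iota 0 h))) = size (pmap v (iota 0 k)).
    apply/perm_size/uniq_perm; rewrite ?undup_uniq // => y.
    rewrite mem_undup !mem_pmap; apply/mapP/mapP => -[j];
      rewrite mem_iota add0n => lt_j /esym ej.
      have [l vl le_l] := uv _ _ ej; exists l => //.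
      rewrite mem_iota add0n /= -dvE ?vl ?vk // -dh (leq_ltn_trans le_l) //.
      by rewrite duE ?ej ?uh.
    have [i ui di] := vu _ _ ej; exists i => //.
    by rewrite mem_iota add0n /= -duE ?ui ?uh // di dh dvE ?ej ?vk.
  (* By [v_le], v has no absent term before k, so [pmap] drops nothing. *)
  rewrite size_pmap -[RHS](size_iota 0); apply/eqP; rewrite -all_count.
  apply/allP => l; rewrite mem_iota => lt_lk.
  by apply: (v_le l k); rewrite ?vk // ltnW.
move=> n x; split=> [/first//|[h [uh min_h <-]]].
have [k vk _] := uv _ _ uh; have [h' [uh' min_h' ek]] := first _ _ vk.
case: (ltngtP h h') => [/min_h'|/min_h|->] //; by rewrite ek.
Qed.

Theorem mainTheorem1 (K KK L : fieldType) (iota : {rmorphism K -> KK})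
    (I : countType) (t : I -> KK)
    (hK : base_field K) (hKK : rational_function_field iota t)
    (sp : specialisation KK L) (F : laurent KK) (hF : specialisable sp F)
    (c : nat -> KK)
    (hc : forall h : nat,
        (exists a : KK, admissible sp F h a) -> admissible sp F h (c h)) :
  [/\ place sp ->
        forall h : nat, has_convergent F h -> admissible sp F h (c h),
      forall h : nat, admissible sp F h (c h) ->
        sp_poly sp (c h *: denom F h) <> 0
    & listed_without_repetition (sp_convergent sp F c)
        (convergent (sp_laurent sp F))].
Proof.
split=> [plc h hFh|h adm|]; first exact/hc/place_admissible.
  exact/eqP/(sp_denom_neq0 hF adm).
set Fb := sp_laurent sp F.
have vE k : isSome (convergent Fb k) = has_convergent Fb k.
  by rewrite /convergent; case: ifP.
have uH h : sp_convergent sp F c h -> has_convergent F h.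
  by case e: sp_convergent => [x|] // _; case: (sp_convergent_bar hF e).
apply: (@listed_without_repetition_by_degree _ _ _
  (fun h => size (denom F h)) (fun k => size (denom Fb k))).
- by move=> j h /uH hj /uH hh; apply: size_denom_ltE.
- by move=> k l; rewrite !vE; apply: size_denom_ltE.
- by move=> k l le_kl; rewrite !vE; apply: has_convergent_le.
- by move=> k l x; apply: convergent_inj.
- by move=> h x /(sp_convergent_bar hF)[_ [k [vk le_k _]]]; exists k.
move=> k x vk; have hk : has_convergent Fb k by rewrite -vE vk.
(* [c h] may differ from the multiplier given by Cramer's rule; [hc] asks only that some multiplier
   exists. *)
have [h [dh /hc adm]] := exists_admissible hF hk; exists h => //.
case e: (sp_convergent sp F c h) => [y|]; last first.
  by move: e; rewrite /sp_convergent; case: excluded_middle_informative.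
have [_ [l [vl le_l lt_l]]] := sp_convergent_bar hF e.
have hl : has_convergent Fb l by rewrite -vE vl.
(* l is the last index whose denominator has degree at most deg y_h, and deg y_h is the degree of
   the k-th denominator, so l = k. *)
suff ekl : k = l by rewrite -vl -ekl.
case: (ltngtP k l) => // [lt_kl|lt_lk].
  by move: le_l; rewrite dh leqNgt size_denom_lt.
have hlS : has_convergent Fb l.+1 := has_convergent_le lt_lk hk.
by have := lt_l hlS; rewrite dh size_denom_ltE // ltnS leqNgt lt_lk.
Qed.
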